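(* Let $(V,E)$ be a tree, $p\ge 1$ an integer, and let $E^*$ be a set of links such that for every two distinct nodes $u,v\in V$ and every $t\in\{1,\dots,p\}$ there is exactly one link between $u$ and $v$ of weight $t$, with weights $w$ and costs $c:E^*\to\mathbb{R}_+\cup\{\infty\}$. Assume the instance is metric. If there exists $F\subseteq E^*$ with $w(F)\le p$ such that $(V,E\cup F)$ is 2-edge-connected, then there exists an optimal such $F$ (minimizing $c(F)$) in which every link has both endpoints among the corner nodes.
   Context: For a link $e$ between $u$ and $v$, $P(e)$ denotes the unique path between $u$ and $v$ in the tree $(V,E)$. A link $f$ is a shadow of a link $e$ if $w(f)\ge w(e)$ and $P(f)\subseteq P(e)$ (as edge sets). The instance is metric if (i) $c(f)\le c(e)$ whenever $f$ is a shadow of $e$, and (ii) for any three links $e=(u,v)$, $f=(v,z)$, $h=(u,z)$ (where $(a,b)$ denotes a link between $a$ and $b$) with $w(h)\ge w(e)+w(f)$ we have $c(h)\le c(e)+c(f)$. Corner nodes are the nodes of the tree of degree 1 or of degree at least 3. Costs and weights of a set are summed. *)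

(* Defs.v *)
From HB Require Import structures.
From mathcomp Require Import all_boot all_order all_algebra.
From mathcomp Require Import boolp reals constructive_ereal.

Set Implicit Arguments.
Unset Strict Implicit.
Unset Printing Implicit Defensive.

Definition rel_connected (V : finType) (r : rel V) : bool :=
  [forall u, forall v, connect r u v].

(* A simple graph on V is given by its edge set E : {set {set V}}, all of
   whose members have cardinality 2. *)
Definition adj (V : finType) (E : {set {set V}}) : rel V :=
  fun u v => [set u; v] \in E.

(* [ucycle] also accepts the closed walk [:: u; v] going back and forth along
   one edge, so that a cycle is a [ucycle] with at least three vertices. *)
Definition acyclic (V : finType) (E : {set {set V}}) : Prop :=
  forall s : seq V, ucycle (adj E) s -> size s < 3.

Definition is_tree (V : finType) (E : {set {set V}}) : Prop :=
  [/\ 0 < #|V|,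
      forall x : {set V}, x \in E -> #|x| = 2,
      rel_connected (adj E)
    & acyclic E].

Definition degree (V : finType) (E : {set {set V}}) (v : V) : nat :=
  #|[set x in E | v \in x]|.

Definition corner (V : finType) (E : {set {set V}}) : {set V} :=
  [set v | (degree E v == 1) || (3 <= degree E v)].

(* The edges of the walk x :: s. *)
Fixpoint walk_edges (V : finType) (x : V) (s : seq V) : {set {set V}} :=
  if s is y :: s' then [set x; y] |: walk_edges y s' else set0.

(* Q is the edge set of a simple path of (V, E) joining the two elements
   of the pair a. *)
Definition joining_path (V : finType) (E : {set {set V}}) (a : {set V})
    (Q : {set {set V}}) : Prop :=
  exists (u v : V) (s : seq V),
    [/\ a = [set u; v], path (adj E) u s, uniq (u :: s), last u s = v
      & Q = walk_edges u s].

(* P(e), for a link e with set of endpoints a. When (V, E) is a tree and a has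
   two elements there is exactly one Q to pick, and set0 is not used. *)
Definition tree_path (V : finType) (E : {set {set V}}) (a : {set V}) :
    {set {set V}} :=
  odflt set0 [pick Q | `[< joining_path E a Q >]].

Definition shadow (V L : finType) (E : {set {set V}}) (ends : L -> {set V})
    (w : L -> nat) (f e : L) : Prop :=
  w e <= w f /\ tree_path E (ends f) \subset tree_path E (ends e).

Definition metric (R : realType) (V L : finType) (E : {set {set V}})
    (ends : L -> {set V}) (w : L -> nat) (c : L -> \bar R) : Prop :=
  (forall e f : L, shadow E ends w f e -> (c f <= c e)%E) /\
  (forall (u v z : V) (e f h : L),
     ends e = [set u; v] -> ends f = [set v; z] -> ends h = [set u; z] ->
     w e + w f <= w h -> (c h <= c e + c f)%E).

(* The links, which may be parallel to each other and to tree edges, are the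
   elements of an abstract type L, so (V, E U F) is a multigraph: its edges
   are the elements of the disjoint union of E and F. *)
Definition augmented_ends (V L : finType) (ends : L -> {set V})
    (a : {set V} + L) : {set V} :=
  match a with inl x => x | inr l => ends l end.

Definition augmented_edges (V L : finType) (E : {set {set V}}) (F : {set L}) :
    {set {set V} + L} :=
  [set inl x | x in E] :|: [set inr l | l in F].

Definition multigraph_connected (V X : finType) (ends : X -> {set V})
    (A : {set X}) : bool :=
  rel_connected (fun u v => [exists a in A, ends a == [set u; v]]).

Definition two_edge_connected (V X : finType) (ends : X -> {set V})
    (A : {set X}) : Prop :=
  multigraph_connected ends A /\
  forall a : X, a \in A -> multigraph_connected ends (A :\ a).

Definition feasible (V L : finType) (E : {set {set V}}) (ends : L -> {set V})
    (w : L -> nat) (p : nat) (F : {set L}) : Prop :=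
  \sum_(l in F) w l <= p /\
  two_edge_connected (augmented_ends ends) (augmented_edges E F).

(* Main.v *)
(* Removing a tree edge splits the vertices into two sides, so the separation
   of u from z is the exclusive or of those of u from v and of v from z.  Hence
   P(u, z) is the symmetric difference of P(u, v) and P(v, z), and F is feasible
   iff w(F) <= p and the paths of its links cover E.
   Let a link e = (u, v) of F end at a node v of degree 2, and let f in F cover
   the edge at v that is not on P(e).  If f = (v, t), replace e and f by the
   link (u, t) of weight w(e) + w(f).  Otherwise f also covers the edge {v, a}
   of P(e) at v, so that e can be shortened to its shadow (u, a), or dropped if
   u = a.  The cost does not increase, while the sum of |P(l)| + 1 over l in F
   decreases, so the process ends with corner nodes only. *)
Require Import Defs.
From HB Require Import structures.
From mathcomp Require Import all_boot all_order all_algebra.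
From mathcomp Require Import boolp reals constructive_ereal.

Set Implicit Arguments.
Unset Strict Implicit.
Unset Printing Implicit Defensive.

Import Order.POrderTheory.

(** * Reachability and unordered pairs *)

Lemma connect_ind (T : finType) (e : rel T) (P : T -> Prop) (u : T) :
    P u -> (forall y z, P y -> e y z -> P z) ->
  forall v, connect e u v -> P v.
Proof.
move=> Pu Pe v /connectP[s]; elim: s u Pu => [|y s IHs] u Pu /= => [_ -> //|].
by case/andP=> uy /IHs IH; apply: IH; apply: Pe uy.
Qed.

Lemma adj_sym (V : finType) (E : {set {set V}}) : symmetric (adj E).
Proof. by move=> u v; rewrite /adj setUC. Qed.

Lemma eq_set2 (T : finType) (a b u v : T) :
  [set a; b] = [set u; v] -> (a = u /\ b = v) \/ (a = v /\ b = u).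
Proof.
move=> abuv.
have: a \in [set u; v] by rewrite -abuv set21.
have: b \in [set u; v] by rewrite -abuv set22.
have: u \in [set a; b] by rewrite abuv set21.
have: v \in [set a; b] by rewrite abuv set22.
rewrite !inE.
by case/orP=> /eqP v_; case/orP=> /eqP u_; case/orP=> /eqP b_; case/orP=> /eqP a_;
  subst; auto.
Qed.

(* For an edge x of a tree this says that x lies on the path from u to v. *)
Definition separates (V : finType) (E : {set {set V}}) (x : {set V}) : rel V :=
  fun u v => ~~ connect (adj (E :\ x)) u v.

(** * Cuts and paths in a tree *)

Section Tree.

Variables (V : finType) (E : {set {set V}}).
Hypothesis treeE : is_tree E.

Let card_edge x : x \in E -> #|x| = 2. Proof. by case: treeE => _ + _ _; apply. Qed.

Let tree_connect u v : connect (adj E) u v.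
Proof. by case: treeE => _ _ /forallP/(_ u)/forallP/(_ v). Qed.

Lemma edge_neq a b : [set a; b] \in E -> a != b.
Proof. by move/card_edge/eqP; rewrite cards2; case: (a != b). Qed.

Lemma edge_ends x : x \in E -> exists a b, x = [set a; b].
Proof. by move/card_edge/eqP/cards2P=> [a [b [_ ->]]]; exists a, b. Qed.

Lemma separatesxx x u : separates E x u u = false.
Proof. by rewrite /separates connect0. Qed.

Let side_sym x : connect_sym (adj (E :\ x)).
Proof. exact/sym_connect_sym/adj_sym. Qed.

Lemma separates_sym x u v : separates E x u v = separates E x v u.
Proof. by rewrite /separates side_sym. Qed.

(** A simple path from [a] to [b] avoiding this edge has at least two edges, so the edge would close
    it to a cycle. *)
Lemma edge_separates_ends a b : [set a; b] \in E -> separates E [set a; b] a b.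
Proof.
move=> abE; apply/negP => /connectP[s].
case/shortenP => [[|y [|z s']]] //= path_s uniq_s _ last_b.
- by move: (edge_neq abE); rewrite last_b eqxx.
- by move: path_s; rewrite -last_b /adj !inE eqxx.
case: treeE => _ _ _ acyclicE.
suff /acyclicE : ucycle (adj E) [:: a, y, z & s'] by [].
apply/andP; split; last exact: uniq_s.
rewrite /= -cats1 cat_path /= -last_b [adj E b a]adj_sym [adj E a b]abE.
rewrite !andbT.
have sub : subrel (adj (E :\ [set a; b])) (adj E).
  by move=> ? ?; rewrite /adj !inE => /andP[].
case/and3P: path_s => /sub-> /sub-> /(sub_path sub)-> //.
Qed.

(** Each step of a tree walk from [a] either keeps the side or crosses the edge itself and lands at
    [a] or [b]. *)
Lemma edge_two_sides a b v : [set a; b] \in E ->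
  separates E [set a; b] a v = ~~ separates E [set a; b] b v.
Proof.
move=> abE; set x := [set a; b].
have : connect (adj (E :\ x)) a v \/ connect (adj (E :\ x)) b v.
  move: v (tree_connect a v); apply: connect_ind; first by left; apply: connect0.
  move=> y z IH yz; have [yzx|yzx] := eqVneq [set y; z] x.
    by case: (eq_set2 yzx) => -[_ ->]; [right | left]; apply: connect0.
  have yz' : connect (adj (E :\ x)) y z by rewrite connect1 // /adj !inE yzx.
  by case: IH => IH; [left | right]; apply: connect_trans yz'.
move: (edge_separates_ends abE); rewrite /separates -/x negbK.
case av: (connect _ a v); case bv: (connect _ b v) => //; last by move=> _ [].
by rewrite (connect_trans av) // side_sym.
Qed.

Lemma separates_addb x u v z : x \in E ->
  separates E x u z = separates E x u v (+) separates E x v z.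
Proof.
move=> xE; have [a [b def_x]] := edge_ends xE; rewrite {x}def_x in xE *.
(* Sides are compared through the base point [a]; in the sum of two such comparisons the term of [v]
   cancels. *)
have from_a y t : separates E [set a; b] y t =
    separates E [set a; b] a y (+) separates E [set a; b] a t.
  rewrite /separates; set C := connect _.
  have Cb v' : ~~ C a v' -> C b v'.
    by have := edge_two_sides v' xE; rewrite /separates => ->; rewrite negbK.
  case ay: (C a y); case at_: (C a t) => /=.
  - by rewrite /C (connect_trans _ at_) // side_sym.
  - by apply/negP => /(connect_trans ay); rewrite -/C at_.
  - by apply/negP; rewrite /C side_sym => /(connect_trans at_); rewrite -/C ay.
  - by rewrite /C (connect_trans _ (Cb t _)) ?at_ // side_sym -/C Cb ?ay.
by rewrite [LHS]from_a [in RHS](from_a u) (from_a v) addbA addbK.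
Qed.

Lemma separates_edge x y z : [set y; z] \in E -> x \in E ->
  separates E x y z = (x == [set y; z]).
Proof.
move=> yzE xE; have [->|neq_x] := eqVneq x; first by rewrite edge_separates_ends.
by apply/negbF/connect1; rewrite /adj !inE eq_sym neq_x.
Qed.

Lemma in_walk_edges (x : {set V}) v u s : x \in walk_edges u s -> v \in x -> v \in u :: s.
Proof.
elim: s u => [|y s IHs] u /=; first by rewrite inE.
rewrite in_setU1 => /orP[/eqP->|/IHs{}IHs /IHs].
  by rewrite !inE => /orP[]->; rewrite ?orbT.
by rewrite [in X in _ -> X]inE => ->; rewrite orbT.
Qed.

(** Induction along the walk: by additivity, prepending an edge changes separation for that edge
    only. *)
Lemma walk_edgesE u s : path (adj E) u s -> uniq (u :: s) ->
  walk_edges u s = [set x in E | separates E x u (last u s)].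
Proof.
elim: s u => [|y s IHs] u /=.
  by move=> _ _; apply/setP=> x; rewrite !inE separatesxx andbF.
case/andP=> uy path_s /andP[u_notin uniq_s].
apply/setP=> x; rewrite in_setU1.
have [xE|xE] := boolP (x \in E); last first.
  rewrite inE (negPf xE) IHs // inE (negPf xE) orbF.
  by apply: contraNF xE => /eqP->.
rewrite inE xE (separates_addb u y) // separates_edge // /=.
have [->|_] := eqVneq; last by rewrite IHs // inE xE.
(* Otherwise this edge would occur again in the rest of the walk, which would return to [u]. *)
apply/esym/negP => sep_uy.
have := @in_walk_edges [set u; y] u y s; rewrite (negPf u_notin) set21.
by rewrite IHs // inE sep_uy [_ \in E]uy => /(_ isT isT).
Qed.

Lemma exists_simple_path u v :
  exists s, [/\ path (adj E) u s, uniq (u :: s) & last u s = v].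
Proof.
have /connectP[s path_s ->] := tree_connect u v.
by case/shortenP: path_s => s' ? ? _; exists s'.
Qed.

(** All simple paths joining the pair have the same edge set, so the choice made by [pick] is
    immaterial; a path exists, which rules out the default. *)
Lemma tree_pathE u v :
  tree_path E [set u; v] = [set x in E | separates E x u v].
Proof.
rewrite /tree_path; case: pickP => [Q /asboolP|] /=; last first.
  have [s [path_s uniq_s last_s]] := exists_simple_path u v.
  by move/(_ (walk_edges u s))/asboolP; case; exists u, v, s.
case=> u' [v' [s [uv path_s uniq_s last_s ->]]].
rewrite walk_edgesE // last_s; apply/setP=> x; rewrite !inE.
by case: (eq_set2 uv) => -[-> ->] //; rewrite separates_sym.
Qed.

(** The node [y] comes second on the simple path from [v] to [u], whose later edges avoid [v]. *)
Lemma first_edge u v : u != v -> exists y, [set v; y] \in E /\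
  forall x, x \in E -> v \in x -> separates E x v u = (x == [set v; y]).
Proof.
have [[|y s] [path_s uniq_s last_s]] := exists_simple_path v u.
  by rewrite -last_s eqxx.
move=> _; case/andP: (path_s) => vy path_ys; case/andP: (uniq_s) => v_notin _.
exists y; split=> // x xE vx.
have /setP/(_ x) := walk_edgesE path_s uniq_s.
rewrite last_s [RHS]inE xE /= => <-; rewrite in_setU1.
case: eqP => //= _; apply/negP => /in_walk_edges/(_ vx).
by apply/negP.
Qed.

(* If z separates v from both u and t, a walk from u to t on the far side of z
   avoids v, hence every edge x at v. *)
Lemma disjoint_tree_paths u v t x : x \in E -> v \in x -> separates E x u t ->
  [disjoint tree_path E [set v; u] & tree_path E [set v; t]].
Proof.
move=> xE vx sep_x; apply/pred0Pn => -[z] /=; rewrite !tree_pathE !inE.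
case/andP=> /andP[zE sep_u] /andP[_ sep_t].
have ut : connect (adj (E :\ z)) u t.
  have := separates_addb u v t zE.
  by rewrite sep_t [separates E z u v]separates_sym sep_u /= => /negbFE.
case/negP: sep_x.
suff : connect (adj (E :\ z)) u t /\ connect (adj (E :\ x)) u t by case.
move: t ut {sep_t}; apply: connect_ind; first by split; apply: connect0.
move=> y t [uy uy'] yt; split; first exact: connect_trans (connect1 yt).
apply: connect_trans uy' (connect1 _); move: (yt).
rewrite /adj !inE => /andP[_ ->]; rewrite andbT.
apply: contra sep_u => /eqP def_x; rewrite side_sym.
move: vx; rewrite -def_x !inE => /orP[]/eqP->//.
exact: connect_trans (connect1 yt).
Qed.

End Tree.

(** * Nodes of degree 2, and sums over a set with one element added *)

Lemma noncorner_edges (V : finType) (E : {set {set V}}) v x1 :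
    v \notin corner E -> x1 \in E -> v \in x1 ->
  exists x2, [/\ x2 \in E, v \in x2, x2 != x1
    & forall x, x \in E -> v \in x -> x = x1 \/ x = x2].
Proof.
set D := [set x in E | v \in x] => + x1E vx1.
have x1D : x1 \in D by rewrite inE x1E.
(* Besides [x1], the edges at [v] number neither 0 nor more than 1. *)
rewrite inE /degree -/D (cardsD1 x1) x1D add1n !eqSS ltnS negb_or -lt0n -leqNgt.
rewrite andbC -eqn_leq => /cards1P[x2 def_x2].
have : x2 \in D :\ x1 by rewrite def_x2 set11.
rewrite !inE => /and3P[x21 x2E vx2]; exists x2; split=> // x xE vx.
have := in_set1 x x2; rewrite -def_x2 !inE xE vx andbT.
by have [|_ /esym/eqP] := eqVneq x x1; [left | right].
Qed.

(** Equality may fail: a link put in place of others may already belong to the set. *)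
Lemma sum_nat_setU1 (I : finType) (g : I -> nat) i (A : {set I}) :
  \sum_(j in i |: A) g j <= g i + \sum_(j in A) g j.
Proof.
have [iA|iA] := boolP (i \in A); last by rewrite big_setU1.
by rewrite (setUidPr _) ?sub1set // leq_addl.
Qed.

Lemma sume_setU1 (R : realType) (I : finType) (g : I -> \bar R) i (A : {set I}) :
  (0 <= g i)%E -> (\sum_(j in i |: A) g j <= g i + \sum_(j in A) g j)%E.
Proof.
move=> g_ge0; have [iA|iA] := boolP (i \in A); last by rewrite big_setU1.
by rewrite (setUidPr _) ?sub1set // leeDr.
Qed.

Lemma other_end (V : finType) (a : {set V}) v :
  #|a| = 2 -> v \in a -> exists2 u, u != v & a = [set u; v].
Proof.
move=> /eqP/cards2P[y [z [neq_yz ->]]]; rewrite !inE => /orP[]/eqP->.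
  by exists z; rewrite 1?eq_sym // setUC.
by exists y.
Qed.

(** * Feasibility as a covering condition *)

Section Links.

Variables (R : realType) (V L : finType) (E : {set {set V}}).
Variables (ends : L -> {set V}) (w : L -> nat) (c : L -> \bar R) (p : nat).
Hypothesis treeE : is_tree E.
Hypothesis ends2 : forall l : L, #|ends l| = 2.

Local Notation P l := (tree_path E (ends l)).

Lemma tree_path_sub l : P l \subset E.
Proof.
have /eqP/cards2P[u [v [_ ->]]] := ends2 l; rewrite tree_pathE //.
by apply/subsetP => x; rewrite inE => /andP[].
Qed.

Let aug (F : {set L}) := augmented_edges E F.

Let aug_inl F x : (inl x \in aug F) = (x \in E).
Proof.
rewrite !inE mem_imset; last by move=> ? ? [].
by rewrite orbC; case: imsetP => // -[].
Qed.

Let aug_inr F l : (inr l \in aug F) = (l \in F).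
Proof.
rewrite !inE orbC mem_imset; last by move=> ? ? [].
by rewrite orbC; case: imsetP => // -[].
Qed.

(** Removing a tree edge leaves two sides, reconnected only by links whose path contains that edge;
    removing a link leaves the whole tree. *)
Lemma two_edge_connectedP (F : {set L}) :
  two_edge_connected (augmented_ends ends) (augmented_edges E F) <->
  forall x, x \in E -> exists2 l, l \in F & x \in P l.
Proof.
split=> [[_ conn] x xE | cover].
  have [/exists_inP//|no_l] := boolP [exists l in F, x \in P l].
  have /edge_ends -/(_ treeE)[a [b def_x]] := xE.
  have sep_ab : separates E x a b by rewrite def_x edge_separates_ends // -def_x.
  case/negP: sep_ab.
  (* Without a covering link, a walk from [a] that avoids [x] never leaves the side of [a], yet one
     reaches [b]. *)
  have := conn (inl x); rewrite aug_inl xE => /(_ isT)/forallP/(_ a)/forallP/(_ b).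
  move: b {def_x}; apply: connect_ind => [|y z ay]; first exact: connect0.
  case/exists_inP=> -[y' | l] /=.
    rewrite in_setD1 aug_inl => /andP[neq y'E] /eqP def_y'.
    apply: connect_trans ay (connect1 _).
    by rewrite /adj !inE -def_y' y'E andbT; apply: contraNneq neq => ->.
  rewrite in_setD1 aug_inr => /andP[_ lF] /eqP def_l.
  apply: connect_trans ay _; apply: contraNT no_l => sep_yz.
  by apply/exists_inP; exists l => //; rewrite def_l tree_pathE // inE xE.
have conn_sub (A : {set {set V} + L}) :
    (forall x, x \in E -> inl x \in A) ->
    multigraph_connected (augmented_ends ends) A.
  move=> subA; apply/forallP => u; apply/forallP => v.
  case: treeE => _ _ /forallP/(_ u)/forallP/(_ v) + _.
  apply: connect_sub => y z yz; apply: connect1.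
  by apply/exists_inP; exists (inl [set y; z]) => //=; apply: subA.
split; first by apply: conn_sub => x; rewrite aug_inl.
case=> [x | l] xA; last by apply: conn_sub => x; rewrite in_setD1 aug_inl.
rewrite aug_inl in xA.
have [l lF] := cover x xA; have /eqP/cards2P[y [z [_ def_l]]] := ends2 l.
rewrite def_l tree_pathE // inE xA /= => sep_yz.
rewrite /multigraph_connected; set e := (X in rel_connected X).
have esym : connect_sym e.
  by apply/sym_connect_sym => s t; rewrite /e setUC.
have e_yz : connect e y z.
  apply/connect1/exists_inP; exists (inr l); last by rewrite /= def_l.
  by rewrite in_setD1 aug_inr.
have same_side s t : ~~ separates E x s t -> connect e s t.
  move/negPn; apply: connect_sub => {}s {}t.
  rewrite /adj in_setD1 => /andP[neq st].
  apply/connect1/exists_inP; exists (inl [set s; t]) => //.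
  by rewrite in_setD1 aug_inl st andbT; apply: contraNneq neq => -[->].
apply/forallP => s; apply/forallP => t; change (connect e s t).
have [sep_st|] := boolP (separates E x s t); last exact: same_side.
have := separates_addb treeE s y t xA; have := separates_addb treeE y z t xA.
rewrite sep_st sep_yz.
(* Nodes on opposite sides are joined through [l], entered at the end on the side of [s]. *)
have [sy|sy] := boolP (separates E x s y);
  have [yt|yt] := boolP (separates E x y t) => //.
  move=> _ _; have := separates_addb treeE s z y xA.
  rewrite sy [separates E x z y]separates_sym // sep_yz.
  case sz: (separates E x s z) => // _.
  apply: connect_trans (same_side _ _ (negbT sz)) _; rewrite esym in e_yz.
  exact: connect_trans e_yz (same_side _ _ yt).
case zt: (separates E x z t) => // _ _.
apply: connect_trans (same_side _ _ sy) (connect_trans e_yz _).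
exact: same_side (negbT zt).
Qed.

(** * Exchange steps that lower the excess *)

Hypothesis w_gt0 : forall l : L, 0 < w l.
Hypothesis links : forall (u v : V) (t : nat), u != v -> 1 <= t <= p ->
  exists! l : L, ends l = [set u; v] /\ w l = t.
Hypothesis c_ge0 : forall l : L, (0 <= c l)%E.
Hypothesis metricc : metric E ends w c.

Lemma exists_link u v t : u != v -> 0 < t <= p ->
  exists2 l, ends l = [set u; v] & w l = t.
Proof. by move=> uv tp; have [l [[? ?] _]] := links uv tp; exists l. Qed.

(** Termination measure. Merging links with disjoint paths need not lower the total path length; the
    successor makes it drop. *)
Definition excess (F : {set L}) := \sum_(l in F) #|P l|.+1.

Definition improvement (F F' : {set L}) :=
  [/\ feasible E ends w p F', (\sum_(l in F') c l <= \sum_(l in F) c l)%E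
    & excess F' < excess F].

(** As [x] is at [v] and separates [u] from [t], the two paths share no edge, so the merged link
    covers all that both covered. *)
Lemma merge_links F e f u v t x :
    feasible E ends w p F -> e \in F -> f \in F ->
    ends e = [set u; v] -> ends f = [set v; t] ->
    x \in E -> v \in x -> separates E x u t ->
  exists F', improvement F F'.
Proof.
move=> [wF /two_edge_connectedP coverF] eF fF def_e def_f xE vx sep_ut.
have neq_ut : u != t by apply: contraTneq sep_ut => ->; rewrite separatesxx.
have disj_ef : [disjoint P e & P f].
  by rewrite def_e setUC def_f (disjoint_tree_paths _ xE).
have neq_fe : f != e.
  apply: contraTneq neq_ut => def_fe; have := def_f; rewrite def_fe def_e setUC.
  by move/eq_set2 => [[_ ->]|[-> ->]]; rewrite eqxx.
have sumF (T : Type) (idx : T) (op : Monoid.com_law idx) (g : L -> T) :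
    \big[op/idx]_(l in F) g l =
    op (op (g e) (g f)) (\big[op/idx]_(l in F :\ e :\ f) g l).
  by rewrite (big_setD1 e) //= (big_setD1 f) ?Monoid.mulmA // !inE neq_fe.
(* The weight is at most [p] because [e] and [f] are distinct members of [F]. *)
have [|h def_h wh] := @exists_link u t (w e + w f) neq_ut.
  by rewrite addn_gt0 w_gt0 (leq_trans _ wF) // sumF leq_addr.
have Ph : P h = P e :|: P f.
  apply/setP=> z; have := disjointFr disj_ef (x := z).
  rewrite in_setU def_e def_f def_h !tree_pathE // !inE.
  have [zE /=|//] := boolP (z \in E); rewrite (separates_addb treeE u v t zE).
  by case: (separates E z u v) => // ->.
exists (h |: (F :\ e :\ f)); split.
- split.
    by apply: leq_trans (sum_nat_setU1 _ _ _) _; rewrite wh -sumF.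
  apply/two_edge_connectedP => z zE; have [l lF zl] := coverF z zE.
  have [le|le] := eqVneq l e; first by exists h; rewrite ?setU11 // Ph inE -le zl.
  have [lf|lf] := eqVneq l f.
    by exists h; rewrite ?setU11 // Ph inE -lf zl orbT.
  by exists l; rewrite // !inE le lf lF orbT.
- apply: le_trans (sume_setU1 _ (c_ge0 h)) _; rewrite sumF leeD2r //.
  by apply: (metricc.2 u v t) => //; rewrite wh.
apply: leq_ltn_trans (sum_nat_setU1 _ _ _) _.
rewrite /excess sumF /= ltn_add2r Ph addSn addnS !ltnS.
by rewrite cardsU leq_subr.
Qed.

(** Since [f] still covers the edge from [v] to [a], [e] need only cover the rest of its path, which
    is the path from [u] to [a]. *)
Lemma shorten_link F e f u v a :
    feasible E ends w p F -> e \in F -> f \in F -> f != e ->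
    ends e = [set u; v] -> [set v; a] \in P e -> [set v; a] \in P f ->
  exists F', improvement F F'.
Proof.
move=> [wF /two_edge_connectedP coverF] eF fF neq_fe def_e xe xf.
have xE := subsetP (tree_path_sub e) _ xe.
have cover_rest z : z \in E -> z \notin P e :\ [set v; a] ->
    exists2 l, l \in F :\ e & z \in P l.
  move=> zE; rewrite in_setD1 => z_rest.
  have [l lF zl] := coverF z zE.
  have [le|le] := eqVneq l e; last by exists l; rewrite // !inE le.
  move: zl z_rest; rewrite le => ->; rewrite andbT negbK => /eqP->.
  by exists f; rewrite // !inE neq_fe.
(* If [u] is [a], nothing is left for [e] to cover, and it is dropped. *)
have [def_u|neq_ua] := eqVneq u a.
  exists (F :\ e); split.
  - split; first by apply: leq_trans wF; rewrite [leqRHS](big_setD1 e) //= leq_addl.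
    apply/two_edge_connectedP => z zE; apply: cover_rest => //.
    rewrite in_setD1 def_e tree_pathE // inE zE separates_edge //=.
      by rewrite def_u setUC andNb.
    by rewrite def_u setUC.
  - by rewrite [leRHS](big_setD1 e) //= leeDr.
  by rewrite /excess [ltnRHS](big_setD1 e) //= addSn ltnS leq_addl.
have [|h def_h wh] := @exists_link u a (w e) neq_ua.
  by rewrite w_gt0 (leq_trans _ wF) // (big_setD1 e) //= leq_addr.
have Ph : P h = P e :\ [set v; a].
  apply/setP=> z; rewrite in_setD1 def_h.
  move: xe; rewrite def_e !tree_pathE // !inE => /andP[_ sep_uv].
  have [zE /=|_] := boolP (z \in E); last by rewrite andbF.
  rewrite (separates_addb treeE u v a zE) (separates_edge treeE xE zE).
  by have [->|_] := eqVneq; rewrite ?sep_uv ?addbF.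
exists (h |: (F :\ e)); split.
- split.
    by apply: leq_trans (sum_nat_setU1 _ _ _) _; rewrite wh -big_setD1.
  apply/two_edge_connectedP => z zE.
  have [|/(cover_rest z zE)[l lF zl]] := boolP (z \in P e :\ [set v; a]).
    by rewrite -Ph; exists h; rewrite ?setU11.
  by exists l; rewrite // in_setU1 lF orbT.
- apply: le_trans (sume_setU1 _ (c_ge0 h)) _.
  rewrite [leRHS](big_setD1 e) //= leeD2r // metricc.1 //.
  by split; rewrite ?wh // Ph subD1set.
apply: leq_ltn_trans (sum_nat_setU1 _ _ _) _.
rewrite /excess [ltnRHS](big_setD1 e) //= ltn_add2r ltnS Ph.
by rewrite [ltnRHS](cardsD1 [set v; a]) xe.
Qed.

Lemma noncorner_improvement F e :
    feasible E ends w p F -> e \in F -> ~~ (ends e \subset corner E) ->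
  exists F', improvement F F'.
Proof.
move=> feasF eF /subsetPn[v ve v_corner].
have [u neq_uv def_e] := other_end (ends2 e) ve.
have [a [xaE first_u]] := first_edge treeE neq_uv.
have [xb [xbE vxb neq_ba only_ab]] := noncorner_edges v_corner xaE (set21 v a).
have sep_a : separates E [set v; a] v u by rewrite first_u ?set21 ?eqxx.
have xa_e : [set v; a] \in P e.
  by rewrite def_e (setUC [set u]) tree_pathE // inE xaE.
have [_ /two_edge_connectedP/(_ xb xbE)[f fF xb_f]] := feasF.
have neq_fe : f != e.
  apply: contraTneq xb_f => ->; rewrite def_e setUC tree_pathE // inE xbE /=.
  by rewrite first_u.
(* Orient [f] so that [t] is its end beyond [xb] and [r] lies on the side of [v]. *)
have [t [r [def_f sep_t sep_r]]] : exists t r, [/\ ends f = [set r; t],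
    separates E xb v t & separates E xb v r = false].
  have /eqP/cards2P[s1 [s2 [_ def_f]]] := ends2 f.
  move: xb_f; rewrite def_f tree_pathE // inE xbE /= (separates_addb treeE _ v) //.
  rewrite [separates E xb s1 v]separates_sym //.
  case s1b: (separates E xb v s1); case s2b: (separates E xb v s2) => // _.
    by exists s1, s2; rewrite setUC.
  by exists s2, s1.
have neq_tv : t != v by apply: contraTneq sep_t => ->; rewrite separatesxx.
have [b [_ first_t]] := first_edge treeE neq_tv.
have def_xb : xb = [set v; b] by apply/eqP; rewrite -first_t.
have sep_at : separates E [set v; a] v t = false.
  by rewrite first_t ?set21 // -def_xb eq_sym (negPf neq_ba).
have [def_r|neq_rv] := eqVneq r v.
  rewrite def_r in def_f.
  apply: (merge_links feasF eF fF def_e def_f xaE (set21 v a)).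
  by rewrite (separates_addb treeE u v t xaE) sep_at addbF separates_sym //.
(* The path from [v] to [r] does not start with [xb], hence starts with [[set v; a]], which
   therefore lies on the path of [f]. *)
have [d [xdE first_r]] := first_edge treeE neq_rv.
apply: (@shorten_link F e f u v a) => //.
rewrite def_f tree_pathE // inE xaE (separates_addb treeE r v t xaE) sep_at addbF.
rewrite separates_sym // first_r ?set21 //=.
case: (only_ab _ xdE (set21 v d)) => [->//|def_xd].
by rewrite first_r // def_xd eqxx in sep_r.
Qed.

(** * Existence of an optimal solution on corner nodes *)

Lemma corner_solution F : feasible E ends w p F ->
  exists F', [/\ feasible E ends w p F',
    (\sum_(l in F') c l <= \sum_(l in F) c l)%E
    & forall l, l \in F' -> ends l \subset corner E].
Proof.
have [n] := ubnP (excess F); elim: n F => // n IHn F /ltnSE-ltFn feasF.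
have [/forall_inP cornerF|] := boolP [forall l in F, ends l \subset corner E].
  by exists F.
rewrite negb_forall_in => /exists_inP[e eF ncorner_e].
have [F1 [feasF1 cF1 ltF1]] := noncorner_improvement feasF eF ncorner_e.
have [F2 [? cF2 ?]] := IHn F1 (leq_trans ltF1 ltFn) feasF1.
by exists F2; split=> //; apply: le_trans cF1.
Qed.

End Links.

Theorem theorem5 (R : realType) (V L : finType) (E : {set {set V}}) (p : nat)
    (ends : L -> {set V}) (w : L -> nat) (c : L -> \bar R)
    (treeE : is_tree E)
    (p_ge1 : 1 <= p)
    (ends2 : forall l : L, #|ends l| = 2)
    (w_gt0 : forall l : L, 0 < w l)
    (links : forall (u v : V) (t : nat), u != v -> 1 <= t <= p ->
       exists! l : L, ends l = [set u; v] /\ w l = t)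
    (c_ge0 : forall l : L, (0 <= c l)%E)
    (metricc : metric E ends w c) :
  (exists F : {set L}, feasible E ends w p F) ->
  exists F : {set L},
    [/\ feasible E ends w p F,
        forall F' : {set L}, feasible E ends w p F' ->
          (\sum_(l in F) c l <= \sum_(l in F') c l)%E
      & forall l : L, l \in F -> ends l \subset corner E].
Proof.
case=> F0 /asboolP feas0.
(* There are finitely many sets of links, so the minimum is attained; moving to corner nodes does
   not raise the cost. *)
have [F /asboolP feasF optF] := Order.TotalTheory.arg_minP
  (P := fun F => `[< feasible E ends w p F >])
  (fun F : {set L} => \sum_(l in F) c l)%E feas0.
have [F1 [feasF1 cF1 cornerF1]] :=
  corner_solution treeE ends2 w_gt0 links c_ge0 metricc feasF.
exists F1; split=> // F' /asboolP/optF.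
exact: Order.POrderTheory.le_trans.
Qed.
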